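(* If $k\ge 3$ is an integer, then for every positive integer $n$, \[ \mathrm{ex}_3(n,\text{Berge-}C_{2k})\le \frac{2k-3}{3}\, \mathrm{ex}(n,C_{2k}). \]
   Context: All graphs and hypergraphs are finite and simple. $C_{2k}$ is the cycle of length $2k$. A hypergraph $\mathcal{H}$ contains a Berge-$F$ (Berge copy of the graph $F$) if there are an injection $\varphi:V(F)\to V(\mathcal{H})$ and an injection $f:E(F)\to E(\mathcal{H})$ with $\{\varphi(u),\varphi(v)\}\subset f(uv)$ for every edge $uv\in E(F)$; otherwise it is Berge-$F$-free. $\mathrm{ex}_r(n,\text{Berge-}F)$ is the maximum number of hyperedges in an $n$-vertex $r$-uniform Berge-$F$-free hypergraph. $\mathrm{ex}(n,F)$ is the maximum number of edges in an $n$-vertex graph with no (not necessarily induced) subgraph isomorphic to $F$. *)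

(* Defs.v *)
From mathcomp Require Import all_boot all_order all_algebra.

Set Implicit Arguments.
Unset Strict Implicit.
Unset Printing Implicit Defensive.

(* A hypergraph on the finite vertex type V is its set of hyperedges
   H : {set {set V}}; simple graphs are the 2-uniform hypergraphs. *)
Definition uniform (V : finType) (r : nat) (H : {set {set V}}) : bool :=
  [forall e in H, #|e| == r].

(* Below, F : {set {set W}} is the edge set of a graph with vertex type W, so
   that phi @: [set u; v] = [set phi u; phi v] for an edge [set u; v]. *)
Definition has_subgraph (W V : finType)
    (F : {set {set W}}) (G : {set {set V}}) : bool :=
  [exists phi : {ffun W -> V},
    injectiveb phi && [forall e in F, phi @: e \in G]].

(* Only the restriction of f to the edge set F is relevant. *)
Definition has_Berge (W V : finType)
    (F : {set {set W}}) (H : {set {set V}}) : bool :=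
  [exists phi : {ffun W -> V}, exists f : {ffun {set W} -> {set V}},
    [&& injectiveb phi, dinjectiveb f F &
        [forall e in F, (f e \in H) && (phi @: e \subset f e)]]].

(* Both maxima range over all (hyper)graphs on the vertex set {0, ..., n-1};
   whenever F has an edge the range is nonempty, as it contains set0. *)
Definition ex_graph (W : finType) (n : nat) (F : {set {set W}}) : nat :=
  \max_(G : {set {set 'I_n}} | uniform 2 G && ~~ has_subgraph F G) #|G|.

Definition ex_Berge (W : finType) (r n : nat) (F : {set {set W}}) : nat :=
  \max_(H : {set {set 'I_n}} | uniform r H && ~~ has_Berge F H) #|H|.

(* The cycle of length l (meaningful for l >= 3); ordS i is i + 1 modulo l. *)
Definition cycle_graph (l : nat) : {set {set 'I_l}} :=
  [set [set i; ordS i] | i : 'I_l].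

(* Main.v *)
(** Two ingredients.

    Let [H] be a Berge-[F]-free hypergraph and match hyperedges with the pairs
    of vertices they contain.  A set [S] of hyperedges minimizing
    [#|H :\: S| + #|N(S)|], where [N(S)] is the set of pairs inside members of
    [S], satisfies Hall's condition on both sides: [N(S)] (the red pairs) is
    matched into [S], and [H :\: S] is matched into pairs outside [N(S)] (the
    blue pairs).  The graph of all red and blue pairs is [F]-free, and
    [#|H|] is at most the number of blue pairs plus the number of cliques of
    the red graph.

    For [F = C_2k], the red neighbourhood of a vertex [v] contains no path on
    [2k - 1] vertices, so by Erdos-Gallai it spans at most
    [(2k - 3) / 2 * deg v] red edges.  Summing over [v], the red graph has at
    most [(2k - 3) / 3] times as many triangles as edges; and each blue edge
    counts for [1 <= (2k - 3) / 3] because [k >= 3]. *)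

Require Import Defs.
From mathcomp Require Import all_boot all_order all_algebra.
From mathcomp Require Import zify lra.

Set Implicit Arguments.
Unset Strict Implicit.
Unset Printing Implicit Defensive.

Import Order.TTheory GRing.Theory Num.Theory.
Local Open Scope ring_scope.

(** * Matchings *)

Section Matching.
Local Open Scope nat_scope.
Variables A B : finType.
Implicit Types (S X : {set A}) (N : A -> {set B}).

Definition nbhd N X : {set B} := \bigcup_(x in X) N x.

Lemma nbhdU N X X' : nbhd N (X :|: X') = nbhd N X :|: nbhd N X'.
Proof. exact: bigcup_setU. Qed.

Lemma nbhdS N X X' : X \subset X' -> nbhd N X \subset nbhd N X'.
Proof. by move=> /setUidPr<-; rewrite nbhdU subsetUl. Qed.

Lemma nbhdD N (D : {set B}) X : nbhd (fun x => N x :\: D) X = nbhd N X :\: D.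
Proof.
apply/setP => b; rewrite inE; apply/bigcupP/andP => [[x xX]|[bD]].
  by rewrite inE => /andP[-> bN]; split=> //; apply/bigcupP; exists x.
by move=> /bigcupP[x xX bN]; exists x; rewrite // inE bD.
Qed.

Lemma nbhd_sub N X x : x \in X -> N x \subset nbhd N X.
Proof. by move=> xX; apply: (bigcup_sup x). Qed.

(** Induction on [#|S|]. A nonempty proper subset [X] with [#|nbhd N X| <= #|X|] splits the problem
    into [X] and [S :\: X], the latter with [nbhd N X] removed. If there is none, every such subset
    has slack, so one element can be matched arbitrarily. *)
Lemma Hall (b0 : B) S N :
  (forall X, X \subset S -> #|X| <= #|nbhd N X|) ->
  exists2 f : A -> B, {in S &, injective f} & {in S, forall x, f x \in N x}.
Proof.
have [m] := ubnP #|S|; elim: m => // m IHm in S N *; rewrite ltnS => leSm hall.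
have [->|[x xS]] := set_0Vmem S.
  by exists (fun=> b0) => x; rewrite inE.
case: (pickP [pred X : {set A} | [&& X \proper S, X != set0 &
                                  #|nbhd N X| <= #|X|]]).
- move=> X /and3P[XS X0 tight].
  have sXS := proper_sub XS.
  have [||f1 f1inj f1N] := IHm X N.
  + exact: leq_trans (proper_card XS) leSm.
  + by move=> Y YX; apply: hall; apply: subset_trans sXS.
  have [||f2 f2inj f2N] := IHm (S :\: X) (fun x => N x :\: nbhd N X).
  + have := cardsD S X; rewrite (setIidPr sXS).
    have : 0 < #|X| by rewrite card_gt0.
    by have := subset_leq_card sXS; lia.
  (* Hall's condition for [X :|: Y], less the tight set [X], leaves the condition for [Y]. *)
  + move=> Y; rewrite subsetD => /andP[YS YX].
    have XY0 : X :&: Y = set0 by apply/eqP; rewrite setI_eq0 disjoint_sym.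
    rewrite nbhdD.
    have := hall (X :|: Y); rewrite subUset sXS YS => /(_ isT).
    rewrite nbhdU cardsU XY0 cards0 subn0.
    have -> : nbhd N X :|: nbhd N Y = nbhd N X :|: (nbhd N Y :\: nbhd N X).
      by apply/setP => b; rewrite !inE; case: (b \in nbhd N X).
    by have := (leq_card_setU (nbhd N X) (nbhd N Y :\: nbhd N X)).1; lia.
  have sep y z : y \in X -> z \in S -> z \notin X -> f1 y != f2 z.
    move=> yX zS zX; apply/eqP => eqf.
    have := f2N z; rewrite !inE zX zS -eqf => /(_ isT) /andP[/negP-nyN _].
    by apply: nyN; apply: (subsetP (nbhd_sub N yX)); apply: f1N.
  exists (fun x => if x \in X then f1 x else f2 x).
  + move=> y z yS zS; case: ifPn => yX; case: ifPn => zX eqf.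
    * exact: f1inj.
    * by have := sep _ _ yX zS zX; rewrite eqf eqxx.
    * by have := sep _ _ zX yS yX; rewrite eqf eqxx.
    * by apply: f2inj; rewrite // inE ?yX ?zX.
  + move=> y yS; case: ifPn => yX; first exact: f1N.
    by have := f2N y; rewrite !inE yX yS => /(_ isT) /andP[].
- move=> loose.
  have [b bN] : exists b, b \in N x.
    apply/set0Pn; rewrite -card_gt0.
    by have := hall [set x]; rewrite sub1set xS cards1 /nbhd big_set1 => ->.
  have [||f finj fN] := IHm (S :\ x) (fun x => N x :\: [set b]).
  + by have := cardsD1 x S; rewrite xS; lia.
  (* A nonempty [Y] has a spare neighbour, so losing [b] does no harm. *)
  + move=> Y YS; rewrite nbhdD.
    have [->|Y0] := eqVneq Y set0; first by rewrite cards0.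
    have := loose Y; rewrite /= Y0 (sub_proper_trans YS (properD1 xS)) /=.
    by have := cardsD1 b (nbhd N Y); lia.
  have neb y : y \in S -> y != x -> f y != b.
    by move=> yS yx; have := fN y; rewrite !inE yx yS => /(_ isT) /andP[].
  exists (fun y => if y == x then b else f y).
  + move=> y z yS zS; case: eqVneq => [->|yx]; case: eqVneq => [->|zx] // eqf.
    * by have := neb z zS zx; rewrite -eqf eqxx.
    * by have := neb y yS yx; rewrite eqf eqxx.
    * by apply: finj; rewrite // !inE ?yx ?zx.
  + move=> y yS; case: eqVneq => [->|yx] //.
    by have := fN y; rewrite !inE yx yS => /(_ isT) /andP[].
Qed.

End Matching.

(** * Koenig's theorem for a bipartite graph *)

Section Koenig.
Local Open Scope nat_scope.
Variables A B : finType.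
Implicit Types (S : {set A}) (N : A -> {set B}).

(** [S0 :\: S] and [nbhd N S] form a minimum vertex cover, and minimality gives Hall's condition on
    both sides. The two matchings merge into one injection [q], and [U] is the set of partners of
    [S0 :\: S]. *)
Lemma Koenig_decomposition (a0 : A) (b0 : B) (S0 : {set A}) N :
  exists S, exists U : {set B}, exists q : B -> A,
  [/\ S \subset S0, [disjoint nbhd N S & U], #|U| = #|S0 :\: S|,
      {in nbhd N S :|: U &, injective q} &
      {in nbhd N S :|: U, forall b, q b \in S0 /\ b \in N (q b)}].
Proof.
case: (@arg_minnP _ set0 [pred S : {set A} | S \subset S0]
  (fun S => #|S0 :\: S| + #|nbhd N S|) (sub0set S0)) => S /= sSS0 minS.
have [|f finj fN] := @Hall A B b0 (S0 :\: S) (fun x => N x :\: nbhd N S).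
  (* Moving [Y] into [S] saves [#|Y|] and costs [#|nbhd N Y :\: nbhd N S|]. *)
  move=> Y; rewrite subsetD nbhdD => /andP[YS0 YS].
  have := minS (S :|: Y); rewrite subUset sSS0 YS0 => /(_ isT).
  have YD : Y \subset S0 :\: S by rewrite subsetD YS0.
  have -> : nbhd N (S :|: Y) = nbhd N S :|: (nbhd N Y :\: nbhd N S).
    by rewrite nbhdU; apply/setP => b; rewrite !inE; case: (b \in nbhd N S).
  rewrite -setDDl [#|_ :\: Y|]cardsD (setIidPr YD).
  have := (leq_card_setU (nbhd N S) (nbhd N Y :\: nbhd N S)).1.
  by have := subset_leq_card YD; lia.
pose M b := [set x in S | b \in N x].
have [|g ginj gN] := @Hall B A a0 (nbhd N S) M.
  (* Dropping [nbhd M X] from [S] costs fewer than [#|X|] elements but uncovers all of [X], against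
     minimality. *)
  move=> X XN; rewrite leqNgt; apply/negP => ltX.
  have MS : nbhd M X \subset S.
    by apply/bigcupsP => b _; apply/subsetP => x; rewrite inE => /andP[].
  have := minS (S :\: nbhd M X).
  rewrite (subset_trans (subsetDl _ _) sSS0) => /(_ isT).
  have sub : nbhd N (S :\: nbhd M X) \subset nbhd N S :\: X.
    rewrite subsetD nbhdS ?subsetDl //= disjoint_subset.
    apply/subsetP => b /bigcupP[x]; rewrite inE => /andP[xM xS] bx.
    rewrite inE; apply: contra xM => bX; apply/bigcupP; exists b => //.
    by rewrite inE xS.
  have := subset_leq_card sub; rewrite cardsD (setIidPr XN).
  have := subset_leq_card XN.
  rewrite !cardsD (setIidPr sSS0).
  rewrite (setIidPr (subset_trans (subsetDl S (nbhd M X)) sSS0)).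
  rewrite cardsD (setIidPr MS).
  by have := subset_leq_card MS; have := subset_leq_card sSS0; lia.
pose finv b := odflt a0 [pick x in S0 :\: S | f x == b].
have finvK : {in S0 :\: S, cancel f finv}.
  move=> x xS; rewrite /finv; case: pickP => [y /andP[yS /eqP]|/(_ x)].
    exact: finj.
  by rewrite /= eqxx andbT xS.
(* [g] takes values in [S] and [finv] in [S0 :\: S] on the image of [f], so the glued map is
   injective. *)
exists S, (f @: (S0 :\: S)), (fun b => if b \in nbhd N S then g b else finv b).
split=> //.
- rewrite disjoint_sym disjoint_subset; apply/subsetP => _ /imsetP[x xS ->].
  by have := fN x xS; rewrite !inE => /andP[].
- exact: card_in_imset.
- have gS b : b \in nbhd N S -> g b \in S by move=> /gN; rewrite inE => /andP[].
  move=> b c; rewrite !inE; case: ifPn => bN /=; case: ifPn => cN /=.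
  + by move=> _ _; apply: ginj.
  + move=> _ /imsetP[x xS ->]; rewrite finvK // => eqg.
    by move: xS; rewrite -eqg inE gS.
  + move=> /imsetP[x xS ->] _; rewrite finvK // => eqg.
    by move: xS; rewrite eqg inE gS.
  + by move=> /imsetP[x xS ->] /imsetP[y yS ->]; rewrite !finvK // => ->.
- move=> b; rewrite inE; case: ifPn => bN /=.
    by move=> _; have := gN b bN; rewrite inE => /andP[/(subsetP sSS0)].
  move=> /imsetP[x xS ->]; rewrite finvK //.
  by have := fN x xS; move: xS; rewrite !inE => /andP[_ ->] /andP[_ ->].
Qed.

End Koenig.

(** * The red-blue graph of a Berge-free hypergraph *)

Section RedBlue.
Local Open Scope nat_scope.
Variables (W V : finType) (F : {set {set W}}).

Definition pairs_in (h : {set V}) := [set p : {set V} | p \subset h & #|p| == 2].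

(** Since [q] injectively sends each red or blue pair to a hyperedge containing it, composing a copy
    of [F] with [q] gives a Berge copy. Hyperedges outside [S] are as many as blue pairs, and those
    in [S] have only red pairs. *)
Lemma red_blue_graph (H : {set {set V}}) :
  ~~ has_Berge F H ->
  exists red blue : {set {set V}},
  [/\ [disjoint red & blue], uniform 2 (red :|: blue),
      ~~ has_subgraph F (red :|: blue) &
      #|H| <= #|blue| + #|[set h in H | pairs_in h \subset red]|].
Proof.
move=> noBerge.
have [S [blue [q [sSH dis cardU qinj qP]]]] :=
  @Koenig_decomposition {set V} {set V} set0 set0 H pairs_in.
exists (nbhd pairs_in S), blue; split=> //.
- by apply/forall_inP => p /qP[_]; rewrite inE => /andP[].
- apply: contra noBerge => /existsP[phi /andP[phi_inj /forall_inP phiF]].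
  apply/existsP; exists phi.
  apply/existsP; exists [ffun e : {set W} => q (phi @: e)].
  apply/and3P; split=> //.
    apply/dinjectiveP => e e' eF e'F; rewrite !ffunE => /qinj eqe.
    by apply: (imset_inj (injectiveP _ phi_inj)); apply: eqe; apply: phiF.
  apply/forall_inP => e /phiF /qP; rewrite ffunE inE => -[-> /andP[-> _]] //.
- rewrite cardU cardsD (setIidPr sSH).
  rewrite -{1}(subnK (subset_leq_card sSH)) leq_add2l subset_leq_card //.
  by apply/subsetP => h hS; rewrite inE (subsetP sSH) //= nbhd_sub.
Qed.

End RedBlue.

(** * The Erdos-Gallai theorem *)

Section Graph.
Local Open Scope nat_scope.
Variables (V : finType) (G : {set {set V}}).
Hypothesis G2 : uniform 2 G.

Definition adj (x y : V) : bool := [set x; y] \in G.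
Definition edges_in (W : {set V}) := [set p in G | p \subset W].
Definition nbrs (W : {set V}) x := [set y in W | adj x y].

Lemma in_nbrs W x y : (y \in nbrs W x) = (y \in W) && adj x y.
Proof. by rewrite inE. Qed.

Lemma adj_sym : symmetric adj.
Proof. by move=> x y; rewrite /adj setUC. Qed.

Lemma card_edge p : p \in G -> #|p| == 2.
Proof. by move: p; apply/forall_inP. Qed.

Lemma adj_neq x y : adj x y -> x != y.
Proof. by move=> /card_edge; rewrite cards2; case: (x != y). Qed.

Lemma card_edges_at (W : {set V}) x :
  x \in W -> #|[set p in edges_in W | x \in p]| = #|nbrs W x|.
Proof.
move=> xW; rewrite -(@card_in_imset _ _ (fun y => [set x; y]) (nbrs W x)).
  apply: eq_card => p; apply/idP/imsetP.
    rewrite !inE => /andP[/andP[pG pW] xp].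
    have /cards2P[a [b [ab ep]]] := card_edge pG.
    move: xp pG pW; rewrite ep !inE => /orP[]/eqP <-{ep} pG pW.
      exists b => //; rewrite in_nbrs /adj pG andbT.
      by apply: (subsetP pW); rewrite !inE eqxx orbT.
    exists a; last by rewrite setUC.
    rewrite in_nbrs /adj setUC pG andbT.
    by apply: (subsetP pW); rewrite !inE eqxx.
  move=> [y yN ->]; move: yN; rewrite in_nbrs => /andP[yW xy].
  by rewrite !inE -/(adj x y) xy subUset !sub1set xW yW eqxx.
move=> y z; rewrite !in_nbrs => /andP[_ /adj_neq xy] /andP[_ /adj_neq xz] /setP eqs.
by have := eqs y; rewrite !inE eqxx orbT eq_sym (negPf xy) => /esym/eqP.
Qed.

Lemma edges_inD1 (W : {set V}) x :
  x \in W -> #|edges_in W| = #|nbrs W x| + #|edges_in (W :\ x)|.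
Proof.
move=> xW; rewrite -card_edges_at //.
rewrite -(cardsID [set p : {set V} | x \in p] (edges_in W)); congr (_ + _).
  by apply: eq_card => p; rewrite !inE.
by apply: eq_card => p; rewrite !inE subsetD1 andbCA [_ && (_ \notin _)]andbC.
Qed.

Lemma double_card_edges_in (W : {set V}) : #|edges_in W|.*2 <= #|W| * #|W|.-1.
Proof.
have : edges_in W \subset [set p : {set V} | p \subset W & #|p| == 2].
  by apply/subsetP => p; rewrite !inE => /andP[/card_edge -> ->].
move=> /subset_leq_card; rewrite cards_draws bin2 -leq_double => le2.
by apply: leq_trans le2 _; rewrite -[leqRHS]odd_double_half leq_addl.
Qed.

(** Drop the path edge into [b]: walk from [x] to [last x s], jump to the far end, walk back to [b],
    and return to [x]. *)
Lemma path_closing (e : rel V) x b s t : symmetric e ->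
  path e x (s ++ b :: t) -> e x b -> e (last x s) (last b t) ->
  cycle e (x :: s ++ rev (b :: t)).
Proof.
move=> e_sym; rewrite cat_path /= => /and3P[pxs _ pbt] xb ab.
have eqr : rev (b :: t) = last b t :: rev (belast b t).
  by rewrite lastI rev_rcons.
rewrite rcons_cat cat_path pxs eqr /= ab rcons_path.
have -> : last (last b t) (rev (belast b t)) = b.
  by rewrite -[LHS]/(last b (last b t :: rev (belast b t))) -eqr rev_cons last_rcons.
rewrite e_sym xb andbT rev_path.
by rewrite (eq_path (e' := e)) // => y z; rewrite e_sym.
Qed.

(** Pigeonhole on the [size s] edges of the path: [I1] holds those whose second endpoint is adjacent
    to [x], [I2] those whose first endpoint is adjacent to [last x s]. A common edge is the
    crossing. *)
Lemma crossing_edges (W : {set V}) x s :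
  {in nbrs W x, forall y, y \in x :: s} ->
  {in nbrs W (last x s), forall y, y \in x :: s} ->
  size s < #|nbrs W x| + #|nbrs W (last x s)| ->
  exists s1 b s2,
    [/\ s = s1 ++ b :: s2, adj x b & adj (last x s1) (last x s)].
Proof.
move=> Nx Nz big_deg.
pose I1 := [set i : 'I_(size s) | adj x (nth x s i)].
pose I2 := [set i : 'I_(size s) | adj (nth x (x :: s) i) (last x s)].
have le1 : #|nbrs W x| <= #|I1|.
  apply: leq_trans (leq_imset_card (fun i : 'I__ => nth x s i) I1).
  apply/subset_leq_card/subsetP => y yN; have := Nx y yN.
  move: yN; rewrite in_nbrs inE => /andP[_ xy]; rewrite eq_sym (negPf (adj_neq xy)) /=.
  move=> ys; have lti : index y s < size s by rewrite index_mem.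
  by apply/imsetP; exists (Ordinal lti); rewrite ?inE /= nth_index.
have le2 : #|nbrs W (last x s)| <= #|I2|.
  apply: leq_trans (leq_imset_card (fun i : 'I__ => nth x (x :: s) i) I2).
  apply/subset_leq_card/subsetP => y yN; have ys := Nz y yN.
  move: yN; rewrite in_nbrs => /andP[_ zy].
  (* A neighbour of the last vertex is not that vertex, so it starts an edge of the path. *)
  have lti : index y (x :: s) < size s.
    have := ys; rewrite -index_mem [size _]/= ltnS leq_eqVlt => /orP[/eqP eqi|//].
    have := nth_index x ys; rewrite eqi -[size s]/(size (x :: s)).-1 nth_last.
    by move=> /= eqy; have := adj_neq zy; rewrite eqy eqxx.
  apply/imsetP; exists (Ordinal lti); last by rewrite [RHS]nth_index.
  by rewrite inE [nth _ _ _]nth_index // adj_sym.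
have : 0 < #|I1 :&: I2|.
  have := cardsUI I1 I2.
  by have := subset_leq_card (subsetT (I1 :|: I2)); rewrite cardsT card_ord; lia.
rewrite card_gt0 => /set0Pn[i]; rewrite !inE => /andP[xb az].
exists (take i s), (nth x s i), (drop i.+1 s); split=> //.
  by rewrite -drop_nth // cat_take_drop.
rewrite -(nth_last x (take i s)) size_takel; last exact: ltnW.
by case: (nat_of_ord i) (ltn_ord i) az => [|j] ltj; rewrite ?take0 ?nth_take.
Qed.

(* Remove either an end of small degree of a longest path, or else the vertex
   set of that path, which then carries a cycle and is a union of components. *)
Lemma Erdos_Gallai l (W : {set V}) :
  (forall p, uniq p -> all (mem W) p -> sorted adj p -> size p <= l.+1) ->
  #|edges_in W|.*2 <= l * #|W|.
Proof.
have [m] := ubnP #|W|; elim: m => // m IHm in W *; rewrite ltnS => leWm short.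
have [->|[w wW]] := set_0Vmem W.
  by have := double_card_edges_in set0; rewrite cards0 muln0.
have IH (X : {set V}) : X \proper W -> #|edges_in X|.*2 <= l * #|X|.
  move=> XW; apply: IHm => [|p up /allP pX]; last apply: short => //.
    exact: leq_trans (proper_card XW) leWm.
  by apply/allP => y /pX; apply: (subsetP (proper_sub XW)).
have [p [up pW sp longest]] : exists p, [/\ uniq p, all (mem W) p, sorted adj p &
    forall q, uniq q -> all (mem W) q -> sorted adj q -> size q <= size p].
  pose P j := [exists t : j.-tuple V, [&& uniq t, all (mem W) t & sorted adj t]].
  have exP : exists j, P j.
    by exists 1; apply/existsP; exists [tuple w]; rewrite /= wW.
  have boundP j : P j -> j <= l.+1.
    by move=> /existsP[t /and3P[ut tW st]]; rewrite -(size_tuple t) short.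
  case: (ex_maxnP exP boundP) => j /existsP[p /and3P[up pW sp]] maxj.
  exists p; split=> // q uq qW sq; rewrite size_tuple; apply: maxj.
  by apply/existsP; exists (in_tuple q); rewrite uq qW.
have all_cons y q : y \in W -> all (mem W) q -> all (mem W) (y :: q).
  by move=> /= -> ->.
case: p up pW sp longest => [|x s] up pW sp longest.
  by have := longest [:: w]; rewrite /= wW => /(_ isT isT isT).
(* A neighbour of an end outside the path would extend it. *)
have Nx : {in nbrs W x, forall y, y \in x :: s}.
  move=> y; rewrite in_nbrs => /andP[yW xy]; apply/negPn/negP => yp.
  have := longest (y :: x :: s); rewrite cons_uniq yp up.
  by rewrite [sorted _ _]/= adj_sym xy ltnn => /(_ isT (all_cons _ _ yW pW) sp).
have Nz : {in nbrs W (last x s), forall y, y \in x :: s}.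
  move=> y; rewrite in_nbrs => /andP[yW zy]; apply/negPn/negP => yp.
  have := longest (rcons (x :: s) y); rewrite rcons_uniq yp up all_rcons pW.
  rewrite [mem W y]yW [sorted _ _]/= rcons_path zy !andbT size_rcons ltnn.
  by move=> /(_ isT isT sp).
have les : size s <= l by have := short _ up pW sp.
have [small_deg|big_deg] := leqP (#|nbrs W x| + #|nbrs W (last x s)|) (size s).
  (* The end of smaller degree has degree at most half of [size s <= l]. *)
  have [u uW degu] : exists2 u, u \in W & #|nbrs W u|.*2 <= l.
    have [xz|zx] := leqP #|nbrs W x| #|nbrs W (last x s)|.
      exists x; first by move: pW => /=/andP[].
      by rewrite -addnn; lia.
    exists (last x s); first by apply: (allP pW); apply: mem_last.
    by rewrite -addnn; lia.
  have := IH _ (properD1 uW); rewrite (edges_inD1 uW) (cardsD1 u W) uW.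
  by rewrite doubleD mulnDr muln1 => le2; apply: leq_add.
have [s1 [b [s2 [es xb az]]]] := crossing_edges Nx Nz big_deg.
pose c := x :: s1 ++ rev (b :: s2).
have cycle_c : cycle adj c.
  apply: path_closing => //; first exact: adj_sym.
    by move: sp; rewrite es.
  by move: az; rewrite es last_cat.
have perm_c : perm_eq (x :: s) c.
  by rewrite /c perm_cons es perm_cat2l perm_sym perm_rev.
(* Cutting the cycle open at [u] and prepending an outside neighbour [y] would give a path longer
   than the longest one. *)
have closed u y : u \in x :: s -> y \in W -> adj u y -> y \in x :: s.
  rewrite (perm_mem perm_c) => uc yW uy; have [i q eqr] := rot_to uc.
  have perm_q : perm_eq (x :: s) (u :: q) by rewrite -eqr perm_sym perm_rot perm_sym.
  apply/negPn/negP => yp.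
  have := longest (y :: u :: q).
  have qW : all (mem W) (u :: q) by rewrite -(perm_all _ perm_q).
  rewrite cons_uniq -(perm_uniq perm_q) up -(perm_mem perm_q) yp.
  rewrite [sorted _ _]/= adj_sym uy.
  move: cycle_c; rewrite -(rot_cycle i) eqr /= rcons_path => /andP[-> _].
  by have /= -> := perm_size perm_q; rewrite ltnn => /(_ isT (all_cons _ _ yW qW) isT).
pose P := [set u in x :: s].
have PW : P \subset W by apply/subsetP => u; rewrite inE => /(allP pW).
have cardP : #|P| = (size s).+1 by rewrite cardsE (card_uniqP up).
have sub : edges_in W \subset edges_in P :|: edges_in (W :\: P).
  apply/subsetP => q; rewrite !inE => /andP[qG qW]; rewrite qG /=.
  have /cards2P[a [d [_ eq]]] := card_edge qG.
  move: qG qW; rewrite eq !subUset !sub1set ![_ \in P]inE ![_ \in _ :\: _]inE.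
  rewrite ![_ \in P]inE => ad /andP[aW dW]; rewrite aW dW !andbT.
  have [ap|ap] /= := boolP (a \in x :: s); first by rewrite (closed a) ?orbT.
  by apply/negP => dp; case/negP: ap; apply: (closed d); rewrite // adj_sym.
have IH' : #|edges_in (W :\: P)|.*2 <= l * #|W :\: P|.
  apply: IH; rewrite properEcard subsetDl cardsD (setIidPr PW) cardP.
  by have := subset_leq_card PW; rewrite cardP; lia.
(* The trivial bound suffices on [P], since [#|P| <= l.+1]. *)
have := double_card_edges_in P; rewrite cardP /= => leP.
have le3 : (size s).+1 * size s <= l * (size s).+1 by rewrite mulnC leq_mul2r les orbT.
have leW := leq_trans (subset_leq_card sub) (leq_card_setU _ _).1.
have -> : #|W| = (size s).+1 + #|W :\: P|.
  by rewrite -cardP -(cardsID P W) (setIidPr PW).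
rewrite mulnDr; apply: leq_trans (leq_add (leq_trans leP le3) IH').
by rewrite -doubleD leq_double.
Qed.

(** * Triangles in a graph without even cycles *)

Lemma double_card_edges : #|G|.*2 = \sum_v #|nbrs setT v|.
Proof.
have -> : #|G|.*2 = \sum_(p in G) \sum_(v in p) 1.
  rewrite -muln2 -sum_nat_const; apply: eq_bigr => p /card_edge/eqP <-.
  by rewrite sum1_card.
rewrite (exchange_big_dep predT) //=; apply: eq_bigr => v _.
rewrite -card_edges_at ?inE // sum1dep_card; apply: eq_card => p.
by rewrite !inE subsetT andbT.
Qed.

(** As vertex sets, triangles can be compared directly with the hyperedges of a 3-uniform
    hypergraph. *)
Definition triangles : {set {set V}} :=
  [set t : {set V} | (#|t| == 3) && (pairs_in t \subset G)].

Lemma card_triangle t : t \in triangles -> #|t| = 3.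
Proof. by rewrite inE => /andP[/eqP]. Qed.

Lemma triangle_edge (t p : {set V}) : t \in triangles -> p \subset t -> #|p| = 2 -> p \in G.
Proof.
rewrite inE => /andP[_ /subsetP tG] pt p2; apply: tG.
by rewrite inE pt p2.
Qed.

(** Deleting [v] sends triangles at [v] injectively to edges among its neighbours. *)
Lemma card_triangles_at v :
  #|[set t in triangles | v \in t]| <= #|edges_in (nbrs setT v)|.
Proof.
rewrite -(@card_in_imset _ _ (fun t => t :\ v)).
  apply/subset_leq_card/subsetP => _ /imsetP[t tT ->].
  move: tT; rewrite inE => /andP[tT vt]; rewrite inE.
  have t3 := card_triangle tT; have := cardsD1 v t; rewrite vt t3 => -[t2].
  rewrite (triangle_edge tT) ?subsetDl //=.
  apply/subsetP => y; rewrite !inE => /andP[yv yt].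
  apply: (triangle_edge tT); last by rewrite cards2 eq_sym yv.
  by rewrite subUset !sub1set vt yt.
move=> t t'; rewrite !inE => /andP[_ vt] /andP[_ vt'] eqD.
by rewrite -(setD1K vt) -(setD1K vt') eqD.
Qed.

(** Sum over [v]: each triangle is counted at three vertices, and the degrees sum to [#|G|.*2]. *)
Lemma card_triangles_le l :
  (forall v, #|edges_in (nbrs setT v)|.*2 <= l * #|nbrs setT v|) ->
  3 * #|triangles| <= l * #|G|.
Proof.
move=> leN; rewrite -leq_double -[(l * _).*2]muln2 -mulnA muln2 double_card_edges.
have -> : 3 * #|triangles| = \sum_v #|[set t in triangles | v \in t]|.
  rewrite mulnC -sum_nat_const.
  rewrite (eq_bigr (fun t : {set V} => \sum_(v in t) 1)); last first.
    by move=> t /card_triangle <-; rewrite sum1_card.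
  rewrite (exchange_big_dep predT) //=; apply: eq_bigr => v _.
  by rewrite sum1dep_card.
rewrite -muln2 big_distrl big_distrr; apply: leq_sum => v _ /=.
by apply: leq_trans (leN v); rewrite muln2 leq_double card_triangles_at.
Qed.

Lemma has_cycle_subgraph c :
  2 < size c -> uniq c -> cycle adj c -> has_subgraph (cycle_graph (size c)) G.
Proof.
case: c => // x s szc uc cc; set c := x :: s in szc uc cc *.
apply/existsP; exists [ffun i : 'I_(size c) => nth x c i]; apply/andP; split.
  apply/injectiveP => i j; rewrite !ffunE => /eqP.
  by rewrite nth_uniq // => /eqP/val_inj.
apply/forall_inP => _ /imsetP[i _ ->]; rewrite imsetU !imset_set1 !ffunE.
move: cc; rewrite -/(adj _ _) => /(pathP x) /(_ i).
rewrite size_rcons => /(_ (ltn_ord i)).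
have -> : nth x (x :: rcons s x) i = nth x c i.
  by rewrite -rcons_cons nth_rcons ltn_ord.
(* The appended [x] realises the wrap-around of [ordS] at the last index. *)
have -> // : nth x (rcons s x) i = nth x c (ordS i).
rewrite nth_rcons /=; have := ltn_ord i; rewrite ltnS leq_eqVlt.
case/orP => [/eqP->|lti]; first by rewrite ltnn eqxx modnn.
by rewrite lti modn_small.
Qed.

(** A path on [2 * k - 1] neighbours of [v] closes through [v] to a cycle of length [2 * k]. So such
    paths have at most [2 * k - 2] vertices, and Erdos-Gallai applies with [l = 2 * k - 3]. *)
Lemma card_triangles_C2k k : 2 < k -> ~~ has_subgraph (cycle_graph (2 * k)) G ->
  3 * #|triangles| <= (2 * k - 3) * #|G|.
Proof.
move=> k3 noC; apply: card_triangles_le => v; apply: Erdos_Gallai.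
move=> p up /allP pN sp; rewrite leqNgt; apply: contra noC => ltp.
pose q := take (2 * k - 1) p.
have szq : size q = 2 * k - 1 by rewrite size_takel //; lia.
have -> : 2 * k = size (v :: q) by rewrite /= szq; lia.
have vq y : y \in q -> adj v y by move=> /mem_take /pN /=; rewrite in_nbrs inE.
apply: has_cycle_subgraph.
- by rewrite /= szq; lia.
- rewrite cons_uniq take_uniq // andbT; apply/negP => /vq /adj_neq.
  by rewrite eqxx.
- have : sorted adj q by apply: take_sorted.
  case: q szq vq => [|y q] /=; first by lia.
  move=> _ vq pq; rewrite rcons_path pq vq ?mem_head //=.
  by rewrite adj_sym vq // mem_last.
Qed.

End Graph.

(** * The bound on the extremal numbers *)

Lemma ex_Berge_C2k_nat k n : (2 < k)%N ->
  (3 * ex_Berge 3 n (cycle_graph (2 * k))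
    <= (2 * k - 3) * ex_graph n (cycle_graph (2 * k)))%N.
Proof.
move=> k3; rewrite /ex_Berge.
elim/big_rec: _ => [|H m /andP[H3 noB] IH]; first by rewrite muln0.
rewrite maxnMr geq_max IH andbT.
have [red [blue [dis G2 noC leH]]] := red_blue_graph noB.
have red2 : uniform 2 red.
  by apply/forall_inP => p pr; apply: (forall_inP G2); rewrite inE pr.
have noCr : ~~ has_subgraph (cycle_graph (2 * k)) red.
  apply: contra noC => /existsP[phi /andP[phi_inj /forall_inP phiF]].
  apply/existsP; exists phi; rewrite phi_inj; apply/forall_inP => e /phiF.
  by rewrite inE => ->.
have tri : (#|[set h in H | pairs_in h \subset red]| <= #|triangles red|)%N.
  apply/subset_leq_card/subsetP => h; rewrite !inE => /andP[hH ->].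
  by rewrite andbT; apply: (forall_inP H3).
have leG : (#|red :|: blue| <= ex_graph n (cycle_graph (2 * k)))%N.
  by apply: leq_bigmax_cond; rewrite G2.
have cardG : #|red :|: blue| = (#|red| + #|blue|)%N.
  by rewrite cardsU; move: dis; rewrite -setI_eq0 => /eqP->; rewrite cards0 subn0.
apply: leq_trans (leq_mul (leqnn _) leG); rewrite cardG mulnDr addnC.
apply: leq_trans (leq_mul (leqnn 3) leH) _; rewrite mulnDr leq_add //.
  (* Blue edges: [3 <= 2 * k - 3] because [k >= 3]. *)
  by apply: leq_mul => //; lia.
apply: leq_trans (card_triangles_C2k red2 k3 noCr).
exact: leq_mul.
Qed.

Unset Implicit Arguments.

Theorem theorem14 (k : nat) (hk : (3 <= k)%N) (n : nat) (hn : (0 < n)%N) :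
  (ex_Berge 3 n (cycle_graph (2 * k)))%:R
    <= (2 * k%:R - 3) / 3 * (ex_graph n (cycle_graph (2 * k)))%:R :> rat.
Proof.
(* Truncated subtraction agrees with the rational one as [3 <= 2 * k]. *)
have := ex_Berge_C2k_nat n hk; rewrite -(ler_nat rat) !natrM natrB; last by lia.
by rewrite natrM; lra.
Qed.
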